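(* Let $G$ be a finite group, let $\Gamma_{\mathrm{EP}}(G)$ be its enhanced power graph, and let $\mathcal{C}\Gamma_{\mathrm{EP}}(G)$ be the complement of $\Gamma_{\mathrm{EP}}(G)$. Then the subgraph of $\mathcal{C}\Gamma_{\mathrm{EP}}(G)$ induced on the set of its non-isolated vertices is connected and has diameter at most $3$; that is, any two non-isolated vertices of $\mathcal{C}\Gamma_{\mathrm{EP}}(G)$ are joined by a path of length at most $3$ in $\mathcal{C}\Gamma_{\mathrm{EP}}(G)$.
   Context: All graphs are simple and undirected. For a finite group $G$, the enhanced power graph $\Gamma_{\mathrm{EP}}(G)$ is the graph with vertex-set $G$ in which two distinct elements $x,y\in G$ are adjacent if and only if they are contained in a common cyclic subgroup of $G$ (equivalently, the subgroup $\langle x,y\rangle$ is cyclic). Its complement $\mathcal{C}\Gamma_{\mathrm{EP}}(G)$ has vertex-set $G$, and two distinct elements $x,y$ are adjacent in it if and only if they are not adjacent in $\Gamma_{\mathrm{EP}}(G)$, i.e. no cyclic subgroup of $G$ contains both. A vertex is isolated if it has no neighbours. The diameter is the maximum of the distances between two vertices, where distance is the length (number of edges) of a shortest path. If there are no non-isolated vertices, the assertion is regarded as vacuously true. *)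

(* Defs.v *)
From mathcomp Require Import all_boot all_fingroup all_solvable.

Set Implicit Arguments.
Unset Strict Implicit.
Unset Printing Implicit Defensive.

Local Open Scope group_scope.

(* A finite simple undirected graph whose vertex set is a subset of a finType;
   adjacency never involves points outside the vertex set. *)
Record sgraph (T : finType) := SGraph {
  verts : {set T};
  adj : rel T;
  adj_sym : symmetric adj;
  adj_irr : irreflexive adj;
  adj_verts : forall x y, adj x y -> x \in verts
}.

Section Graphs.

Variable T : finType.
Implicit Types (g : sgraph T) (A : {set T}) (x y : T) (p : seq T).

Definition compl_adj g : rel T :=
  fun x y => [&& x \in verts g, y \in verts g, x != y & ~~ adj g x y].

Lemma compl_adj_sym g : symmetric (compl_adj g).
Proof.
by move=> x y; rewrite /compl_adj eq_sym (adj_sym g x y) andbCA.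
Qed.

Lemma compl_adj_irr g : irreflexive (compl_adj g).
Proof. by move=> x; rewrite /compl_adj eqxx !andbF. Qed.

Lemma compl_adj_verts g x y : compl_adj g x y -> x \in verts g.
Proof. by case/and4P. Qed.

Definition compl_graph g : sgraph T :=
  SGraph (compl_adj_sym g) (compl_adj_irr g) (@compl_adj_verts g).

Definition induced_adj g A : rel T :=
  fun x y => [&& x \in A, y \in A & adj g x y].

Lemma induced_adj_sym g A : symmetric (induced_adj g A).
Proof. by move=> x y; rewrite /induced_adj (adj_sym g x y) andbCA. Qed.

Lemma induced_adj_irr g A : irreflexive (induced_adj g A).
Proof. by move=> x; rewrite /induced_adj adj_irr !andbF. Qed.

Lemma induced_adj_verts g A x y :
  induced_adj g A x y -> x \in verts g :&: A.
Proof. by case/and3P=> xA _ /adj_verts xg; rewrite inE xg. Qed.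

Definition induced_graph g A : sgraph T :=
  SGraph (induced_adj_sym g A) (induced_adj_irr g A)
         (@induced_adj_verts g A).

Definition isolated g x : bool :=
  (x \in verts g) && ~~ [exists y, adj g x y].

Definition non_isolated g : {set T} :=
  [set x in verts g | ~~ isolated g x].

(* The path has vertices x :: p, so its length (number of edges) is size p. *)
Definition is_path g x y p : bool :=
  [&& path (adj g) x p, last x p == y & uniq (x :: p)].

Definition connected g : Prop :=
  {in verts g &, forall x y, connect (adj g) x y}.

(* The least length of a path from x to y. A path has fewer than #|T| edges, so
   the search is exhaustive; it returns #|T| when there is no path. *)
Definition distance g x y : nat :=
  find (fun n => [exists p : n.-tuple T, is_path g x y p]) (iota 0 #|T|).

(* Meaningful for connected graphs only, in view of the default value of
   distance; the diameter of the empty graph is 0. *)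
Definition diameter g : nat :=
  \max_(x in verts g) \max_(y in verts g) distance g x y.

End Graphs.

Section EnhancedPowerGraph.

Variables (gT : finGroupType) (G : {group gT}).

Definition ep_adj : rel gT :=
  fun x y => [&& x \in G, y \in G, x != y &
    [exists C : {group gT},
      [&& C \subset G, cyclic C, x \in C & y \in C]]].

Lemma ep_adj_sym : symmetric ep_adj.
Proof.
move=> x y; rewrite /ep_adj eq_sym andbCA; do 3!congr (_ && _).
by apply: eq_existsb => C; do 2!congr (_ && _); rewrite andbC.
Qed.

Lemma ep_adj_irr : irreflexive ep_adj.
Proof. by move=> x; rewrite /ep_adj eqxx !andbF. Qed.

Lemma ep_adj_verts x y : ep_adj x y -> x \in (G : {set gT}).
Proof. by case/and4P. Qed.

Definition enhanced_power_graph : sgraph gT :=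
  SGraph ep_adj_sym ep_adj_irr ep_adj_verts.

End EnhancedPowerGraph.

(* Main.v *)
Require Import Defs.
From mathcomp Require Import all_boot all_fingroup all_solvable.

(** Let [x] and [y] be non-isolated, distinct and non-adjacent in the complement,
    with neighbours [a] of [x] and [b] of [y]. If [a] and [b] are adjacent, then
    [x, a, b, y] is a path. Otherwise [a] and [b] lie in a cyclic group [<[c]>];
    a cyclic group containing [x] and [c] would contain [x] and [a], so [c] is
    adjacent to [x], and likewise to [y], and [x, c, y] is a path. *)

Set Implicit Arguments.
Unset Strict Implicit.
Unset Printing Implicit Defensive.

Local Open Scope group_scope.

Section Paths.

Variables (T : finType) (g : sgraph T).

(** A path repeats no vertex, so its length is below [#|T|] and lies in the range searched by
    [find]; the first success comes no later. *)
Lemma distance_le_size x y (p : seq T) : is_path g x y p -> distance g x y <= size p.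
Proof.
move=> gp; have /and3P[_ _ /card_uniqP up] := gp.
have ltpT : size p < #|T| by rewrite -[(size p).+1]/(size (x :: p)) -up max_card.
rewrite leqNgt; apply/negP => /(before_find 0); rewrite nth_iota // add0n.
by move/existsP; case; exists (in_tuple p).
Qed.

Lemma is_path_connect x y (p : seq T) : is_path g x y p -> connect (adj g) x y.
Proof. by case/and3P=> gp /eqP <- _; apply/connectP; exists p. Qed.

Lemma diameter_le n :
    {in verts g &, forall x y, exists2 p, is_path g x y p & size p <= n} ->
  diameter g <= n.
Proof.
move=> short; apply/bigmax_leqP => x gx; apply/bigmax_leqP => y gy.
by have [p /distance_le_size/leq_trans lep /lep] := short x y gx gy.
Qed.

Lemma non_isolatedP x : reflect (exists y, adj g x y) (x \in non_isolated g).
Proof.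
rewrite inE /isolated negb_and negbK.
apply: (iffP idP) => [/andP[-> /existsP //]|[y gxy]].
by rewrite (adj_verts gxy); apply/existsP; exists y.
Qed.

(** The two ends of an edge witness each other's non-isolation, so every edge of the path survives
    in the induced graph. *)
Lemma is_path_non_isolated x y (p : seq T) :
  is_path g x y p -> is_path (induced_graph g (non_isolated g)) x y p.
Proof.
case/and3P=> gp lastp up; apply/and3P; split=> //.
apply: sub_path gp => u v guv; apply/and3P; split=> //; apply/non_isolatedP.
  by exists v.
by exists u; rewrite adj_sym.
Qed.

(** This is the purely graph-theoretic half: groups enter only through the common-neighbour
    hypothesis. That hypothesis also covers [a = b], since adjacency is irreflexive. *)
Lemma non_isolated_short_path :
    (forall x y a b, adj g x a -> adj g y b -> ~~ adj g a b ->
       exists2 c, adj g x c & adj g y c) ->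
  {in non_isolated g &, forall x y, exists2 p, is_path g x y p & size p <= 3}.
Proof.
move=> common x y /non_isolatedP[a xa] /non_isolatedP[b yb].
have neq u v : adj g u v -> u != v by apply: contraTneq => ->; rewrite adj_irr.
have [<-|neq_xy] := eqVneq x y; first by exists [::]; rewrite // /is_path /= eqxx.
have [xy|nxy] := boolP (adj g x y).
  by exists [:: y]; rewrite // /is_path /= xy inE neq_xy eqxx.
have [ab|nab] := boolP (adj g a b); last first.
  have [c xc yc] := common x y a b xa yb nab.
  exists [:: c; y]; rewrite // /is_path /= xc adj_sym yc !inE negb_or eqxx.
  by rewrite neq_xy neq // eq_sym neq.
(* As [is_path] requires distinct vertices, [a = y] and [x = b] must be excluded: either one would
   make [x] and [y] adjacent. *)
have ay : a != y by apply: contraNneq nxy => <-.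
have xb : x != b by apply: contraNneq nxy => ->; rewrite adj_sym.
exists [:: a; b; y]; rewrite // /is_path /= xa ab adj_sym yb !inE !negb_or eqxx.
by rewrite neq_xy ay xb (neq x a) // (neq a b) // eq_sym neq.
Qed.

End Paths.

Section ComplementEnhancedPowerGraph.

Variables (gT : finGroupType) (G : {group gT}).

Let CG := compl_graph (enhanced_power_graph G).

(** Cyclic subgroups are traded for their generators. Distinctness of [x] and [y] is absorbed: if
    they were equal, [z = x] would violate the last condition. *)
Lemma compl_epP x y :
  reflect [/\ x \in G, y \in G &
    forall z, z \in G -> x \in <[z]> -> y \notin <[z]>] (adj CG x y).
Proof.
apply: (iffP and4P) => [[Gx Gy neq_xy]|[Gx Gy nC]].
  rewrite /= /ep_adj Gx Gy neq_xy /= negb_exists => /forallP nC.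
  split=> // z Gz xz; apply: contra (nC <[z]>%G) => yz.
  by rewrite /= cycle_subG Gz cycle_cyclic xz.
split=> //.
  by apply: contraTneq (nC x Gx (cycle_id x)) => <-; rewrite negbK cycle_id.
apply/negP => /and4P[_ _ _ /existsP[C /and4P[sCG /cyclicP[z defC]]]].
rewrite defC => xz; apply/negP; apply: nC => //.
by rewrite -cycle_subG -defC.
Qed.

Lemma compl_ep_cycle x a c :
  c \in G -> a \in <[c]> -> adj CG x a -> adj CG x c.
Proof.
move=> Gc ac /compl_epP[Gx _ nC]; apply/compl_epP; split=> // z Gz xz.
by apply: contra (nC z Gz xz); rewrite -cycle_subG => /subsetP/(_ _ ac).
Qed.

Lemma non_adj_common_cycle a b :
    a \in G -> b \in G -> ~~ adj CG a b ->
  exists c, [/\ c \in G, a \in <[c]> & b \in <[c]>].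
Proof.
move=> Ga Gb /compl_epP nab.
have [/existsP[c /and3P[]]|] := boolP [exists c in G, (a \in <[c]>) && (b \in <[c]>)].
  by move=> Gc ac bc; exists c.
rewrite negb_exists => /forallP nC; case: nab; split=> // z Gz az.
by have := nC z; rewrite Gz az.
Qed.

Lemma compl_ep_common_neighbour x y a b :
    adj CG x a -> adj CG y b -> ~~ adj CG a b ->
  exists2 c, adj CG x c & adj CG y c.
Proof.
move=> xa yb nab; have /compl_epP[_ Ga _] := xa; have /compl_epP[_ Gb _] := yb.
have [c [Gc ac bc]] := non_adj_common_cycle Ga Gb nab.
by exists c; [apply: compl_ep_cycle ac xa | apply: compl_ep_cycle bc yb].
Qed.

End ComplementEnhancedPowerGraph.

Theorem theorem1 (gT : finGroupType) (G : {group gT}) :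
  let CG := compl_graph (enhanced_power_graph G) in
  let H := induced_graph CG (non_isolated CG) in
  [/\ connected H,
      diameter H <= 3 &
      forall x y : gT, x \in non_isolated CG -> y \in non_isolated CG ->
        exists p : seq gT, is_path CG x y p /\ size p <= 3].
Proof.
move=> CG H.
have short := non_isolated_short_path (@compl_ep_common_neighbour gT G).
(* The vertex set of [H] is an intersection with [non_isolated CG]. Short paths inside [H] itself
   give both its connectedness and its diameter bound. *)
have shortH : {in verts H &, forall x y, exists2 p, is_path H x y p & size p <= 3}.
  move=> x y /setIP[_ nx] /setIP[_ ny]; have [p gp lep] := short x y nx ny.
  by exists p; first apply: is_path_non_isolated.
split.
- by move=> x y Hx Hy; have [p /is_path_connect] := shortH x y Hx Hy.
- exact: diameter_le.
- by move=> x y nx ny; have [p gp lep] := short x y nx ny; exists p.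
Qed.
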